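(* Let $F:\mathbb{R}^d\to\mathbb{R}^d$ be $L$-Lipschitz, let $G:\mathbb{R}^d\rightrightarrows\mathbb{R}^d$ be maximally monotone, and assume the problem of finding $x$ with $0\in F(x)+G(x)$ has a nonempty solution set. Assume $F+G$ is maximally $\rho$-cohypomonotone for some $\rho>0$. Let $\eta<\frac{1}{L}$ and suppose $\rho<\eta$. Let $(x_k)$ be generated by the inexact Halpern iteration described in the context, and let $x^\star$ be a solution. Then for any $k=1,\dots,K$, $$\frac{1}{\eta^2}\|x_k-J_{\eta(F+G)}(x_k)\|^2\le\frac{16\|x_0-x^\star\|^2}{(\eta-\rho)^2(k+1)^2}.$$ Moreover, the number of first-order oracle calls used at iteration $k$ is at most $2N_k$, where $N_k=\left\lceil\frac{4(1+\eta L)}{1-\eta L}\log\big(98\sqrt{k+2}\,\log(k+2)\big)\right\rceil$.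
   Context: For an operator $A$, $J_A=(\mathrm{Id}+A)^{-1}$ denotes its resolvent. $F+G$ is $\rho$-cohypomonotone if $\langle u-v,x-y\rangle\ge-\rho\|u-v\|^2$ for all $(x,u),(y,v)$ in the graph of $F+G$; maximal means its graph is not strictly contained in the graph of another $\rho$-cohypomonotone operator. A first-order oracle call consists of one evaluation of $F$ and one resolvent evaluation of (a positive multiple of) $G$. Subroutine FBF$(z_0,N,A,B_{\mathrm{in}},L_B)$: set $\tau=\frac{1}{2L_B}$ and $B(\cdot)=B_{\mathrm{in}}(\cdot)-z_0$; for $t=0,\dots,N-1$: $z_{t+1/2}=J_{\tau A}(z_t-\tau B(z_t))$, $z_{t+1}=z_{t+1/2}+\tau B(z_t)-\tau B(z_{t+1/2})$; output $z_N$. Inexact Halpern iteration: given $x_0\in\mathbb{R}^d$, $K\ge1$, set $\beta_k=\frac{1}{k+2}$, $\alpha=1-\frac{\rho}{\eta}$. For $k=0,\dots,K-1$: $\widetilde J_{\eta(F+G)}(x_k)=\mathrm{FBF}(x_k,N_k,\eta G,\mathrm{Id}+\eta F,1+\eta L)$ with $N_k=\left\lceil\frac{4(1+\eta L)}{1-\eta L}\log(98\sqrt{k+2}\log(k+2))\right\rceil$, and $x_{k+1}=\beta_kx_0+(1-\beta_k)\big((1-\alpha)x_k+\alpha\widetilde J_{\eta(F+G)}(x_k)\big)$. *)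

(* Defs.v *)
From HB Require Import structures.
From mathcomp Require Import all_boot all_order all_algebra.
From mathcomp Require Import all_classical all_reals all_analysis.
Set Implicit Arguments. Unset Strict Implicit. Unset Printing Implicit Defensive.
Import Order.TTheory GRing.Theory Num.Theory.
Local Open Scope ring_scope.
Local Open Scope classical_set_scope.

Section Defs.
Variables (R : realType) (d : nat).
Local Notation vec := 'rV[R]_d.

Definition dotv (u v : vec) : R := (u *m v^T) 0 0.
Definition norm2 (u : vec) : R := dotv u u.
Definition normv (u : vec) : R := Num.sqrt (norm2 u).

Definition op := vec -> set vec.

Definition lipschitz_op (F : vec -> vec) (L : R) : Prop :=
  forall x y, normv (F x - F y) <= L * normv (x - y).

Definition monotone_op (A : op) : Prop :=
  forall x u y v, A x u -> A y v -> 0 <= dotv (u - v) (x - y).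

Definition maximally_monotone (A : op) : Prop :=
  monotone_op A /\
  forall B : op, monotone_op B -> (forall x u, A x u -> B x u) ->
    forall x u, B x u -> A x u.

Definition cohypomonotone (rho : R) (A : op) : Prop :=
  forall x u y v, A x u -> A y v -> - rho * norm2 (u - v) <= dotv (u - v) (x - y).

Definition maximally_cohypomonotone (rho : R) (A : op) : Prop :=
  cohypomonotone rho A /\
  forall B : op, cohypomonotone rho B -> (forall x u, A x u -> B x u) ->
    forall x u, B x u -> A x u.

Definition sum_op (F : vec -> vec) (G : op) : op :=
  fun x => [set F x + g | g in G x].

Definition scale_op (c : R) (A : op) : op := fun x => [set c *: u | u in A x].

(* graph of the resolvent J_A = (Id + A)^{-1}:  y \in J_A(x)  iff  x - y \in A y *)
Definition resolvent_rel (A : op) (x y : vec) : Prop := A y (x - y).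

(* a (classically chosen) point of J_A(x); for maximally monotone A this is
   the unique value of the single-valued resolvent (Minty) *)
Definition resolvent_pt (A : op) (x : vec) : vec := xget x [set y | resolvent_rel A x y].

(* FBF(z0, N, A, Bin, LB), instrumented to count evaluations:
   returns (z_N, #evaluations of Bin, #resolvent evaluations). *)
Definition fbf_step (A : op) (Bin : vec -> vec) (LB : R) (z0 : vec)
    (s : vec * nat * nat) : vec * nat * nat :=
  let tau := (2 * LB)^-1 in
  let B := fun z => Bin z - z0 in
  let: (z, nB, nJ) := s in
  let b := B z in
  let zh := resolvent_pt (scale_op tau A) (z - tau *: b) in
  let bh := B zh in
  (zh + tau *: b - tau *: bh, (nB + 2)%N, nJ.+1).

Definition fbf_run (A : op) (Bin : vec -> vec) (LB : R) (z0 : vec) (N : nat)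
  : vec * nat * nat := iter N (fbf_step A Bin LB z0) (z0, 0%N, 0%N).

Definition fbf (A : op) (Bin : vec -> vec) (LB : R) (z0 : vec) (N : nat) : vec :=
  (fbf_run A Bin LB z0 N).1.1.

Definition Nk (eta L : R) (k : nat) : nat :=
  `| Num.ceil (4 * (1 + eta * L) / (1 - eta * L) *
        ln (98 * Num.sqrt (k.+2%:R) * ln (k.+2%:R))) |%N.

Definition inexact_resolvent (F : vec -> vec) (G : op) (eta L : R) (k : nat) (x : vec)
  : vec := fbf (scale_op eta G) (fun z => z + eta *: F z) (1 + eta * L) x (Nk eta L k).

(* number of first-order oracle calls (one F evaluation + one resolvent
   evaluation of a multiple of G per call) used at iteration k *)
Definition oracle_calls (F : vec -> vec) (G : op) (eta L : R) (k : nat) (x : vec) : nat :=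
  let r := fbf_run (scale_op eta G) (fun z => z + eta *: F z) (1 + eta * L) x (Nk eta L k) in
  maxn r.1.2 r.2.

Fixpoint halpern (F : vec -> vec) (G : op) (eta L rho : R) (x0 : vec) (k : nat) : vec :=
  match k with
  | 0%N => x0
  | k'.+1 =>
      let xk := halpern F G eta L rho x0 k' in
      let beta := (k'.+2%:R)^-1 in
      let alpha := 1 - rho / eta in
      beta *: x0 + (1 - beta) *:
        ((1 - alpha) *: xk + alpha *: inexact_resolvent F G eta L k' xk)
  end.

End Defs.

(* Main.v *)
Require Import Defs.
From HB Require Import structures.
From mathcomp Require Import all_boot all_order all_algebra.
From mathcomp Require Import all_classical all_reals all_analysis.
From mathcomp Require Import ring lra.
Import Order.TTheory GRing.Theory Num.Theory.
Import numFieldNormedType.Exports.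
Local Open Scope ring_scope.

(** Write [J] for the resolvent of [eta (F + G)] and [S = (1 - rho / eta) (Id - J)].
    Cohypomonotonicity says exactly that [S] is 1-cocoercive, and the iteration is
    [x_{k+1} = b_k x_0 + (1 - b_k) (x_k - S x_k + e_k)] where [e_k] is the FBF error.
    Since [eta F] is a contraction, [J] is everywhere defined: [J x] is the fixed
    point of [y |-> J_{eta G} (x - eta F y)], and [J_{eta G}] is total by Minty's
    theorem. One FBF step multiplies the squared distance to [J x] by at most
    [(3 + q) / (3 + 4 q) <= exp (- q / 2)], [q = (1 - eta L) / (1 + eta L)], so the
    choice of [N_k] yields [|e_k|^2 <= |S x_k|^2 / (98^2 (k+2) ln^2 (k+2))].
    The potential [k (k+1) / 2 |S x_k|^2 + (k+1) <S x_k, x_k - x_0>] increases at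
    step [k] by at most a multiple of [|x_0 - x*|^2 (1 / (k ln^2 k) + 1 / k^2)], which
    is summable; hence it stays below [4 |x_0 - x*|^2], and this gives the rate. *)

(** * Inner product and squared norm on row vectors *)

Section EuclideanDot.
Context {R : realType} {d : nat}.
Local Notation vec := 'rV[R]_d.
Implicit Types u v w : vec.

Lemma dotvE u v : dotv u v = \sum_i u 0 i * v 0 i.
Proof. by rewrite /dotv !mxE; apply: eq_bigr => i _; rewrite !mxE. Qed.

Lemma dotvC u v : dotv u v = dotv v u.
Proof. by rewrite !dotvE; apply: eq_bigr => i _; rewrite mulrC. Qed.

Lemma dotvDl u v w : dotv (u + v) w = dotv u w + dotv v w.
Proof. by rewrite !dotvE -big_split; apply: eq_bigr => i _; rewrite mxE mulrDl. Qed.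

Lemma dotvZl (a : R) u v : dotv (a *: u) v = a * dotv u v.
Proof. by rewrite !dotvE mulr_sumr; apply: eq_bigr => i _; rewrite mxE mulrA. Qed.

Lemma dotvNl u v : dotv (- u) v = - dotv u v.
Proof. by rewrite -scaleN1r dotvZl mulN1r. Qed.

Lemma dotvDr u v w : dotv w (u + v) = dotv w u + dotv w v.
Proof. by rewrite dotvC dotvDl !(dotvC w). Qed.

Lemma dotvZr (a : R) u v : dotv v (a *: u) = a * dotv v u.
Proof. by rewrite dotvC dotvZl dotvC. Qed.

Lemma dotvNr u v : dotv v (- u) = - dotv v u.
Proof. by rewrite dotvC dotvNl dotvC. Qed.

Definition dotv_lin := (dotvDl, dotvDr, dotvZl, dotvZr, dotvNl, dotvNr).

Lemma norm2_ge0 u : 0 <= norm2 u.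
Proof. by rewrite /norm2 dotvE; apply: sumr_ge0 => i _; rewrite -expr2 sqr_ge0. Qed.

Lemma norm2_coord u i : (u 0 i) ^+ 2 <= norm2 u.
Proof.
rewrite /norm2 dotvE (bigD1 i) //= -expr2 lerDl.
by apply: sumr_ge0 => j _; rewrite -expr2 sqr_ge0.
Qed.

Lemma norm2_le0 u : norm2 u <= 0 -> u = 0.
Proof.
move=> u0; apply/rowP => i; rewrite mxE; apply/eqP.
by rewrite -sqrf_eq0 eq_le sqr_ge0 andbT (le_trans (norm2_coord u i)).
Qed.

Lemma norm2N u : norm2 (- u) = norm2 u.
Proof. by rewrite /norm2 !dotv_lin opprK. Qed.

Lemma norm2Z (a : R) u : norm2 (a *: u) = a ^+ 2 * norm2 u.
Proof. by rewrite /norm2 !dotv_lin mulrA. Qed.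

Lemma norm2_0 : norm2 (0 : vec) = 0.
Proof. by rewrite -[X in norm2 X](scale0r (0 : vec)) norm2Z expr2 !mul0r. Qed.

Lemma norm2D u v : norm2 (u + v) = norm2 u + 2 * dotv u v + norm2 v.
Proof. rewrite /norm2 !dotv_lin (dotvC v u); lra. Qed.

Lemma dotv_young u v (s : R) : 0 < s ->
  2 * dotv u v <= s * norm2 u + s^-1 * norm2 v.
Proof.
move=> s0; have := norm2_ge0 (s *: u - v).
rewrite norm2D norm2N norm2Z dotvZl dotvNr => h.
have -> : s * norm2 u + s^-1 * norm2 v = s^-1 * (s ^+ 2 * norm2 u + norm2 v) by field; lra.
have -> : 2 * dotv u v = s^-1 * (s * (2 * dotv u v)) by field; lra.
by rewrite ler_pM2l ?invr_gt0//; lra.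
Qed.

Lemma norm2D_young u v (s : R) : 0 < s ->
  norm2 (u + v) <= (1 + s) * norm2 u + (1 + s^-1) * norm2 v.
Proof. by move=> /(dotv_young u v); rewrite norm2D; lra. Qed.

Lemma norm2D_le2 u v : norm2 (u + v) <= 2 * norm2 u + 2 * norm2 v.
Proof. by have := norm2D_young u v 1 ltr01; rewrite invr1; lra. Qed.

(** Cauchy-Schwarz without square roots: Young's inequality at weight [c^-1], with [c = 0] apart
    because it forces [u = 0]. *)
Lemma dotv_ge_of_norm2 u v (c : R) : 0 <= c -> norm2 u <= c ^+ 2 * norm2 v ->
  - (c * norm2 v) <= dotv u v.
Proof.
rewrite le0r => /orP[/eqP->|c0] h.
  have -> : u = 0 by apply: norm2_le0; move: h; rewrite expr2 mul0r mul0r.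
  by rewrite -[X in dotv X _](scale0r v) dotvZl !mul0r oppr0.
have ci : 0 < c^-1 by rewrite invr_gt0.
have := dotv_young (- u) v _ ci; rewrite norm2N dotvNl invrK.
have : c^-1 * norm2 u <= c^-1 * (c ^+ 2 * norm2 v) by rewrite ler_pM2l.
have -> : c^-1 * (c ^+ 2 * norm2 v) = c * norm2 v by field; lra.
lra.
Qed.

Lemma lipschitz_op_norm2 (F : vec -> vec) (L : R) x y : 0 <= L -> lipschitz_op F L ->
  norm2 (F x - F y) <= L ^+ 2 * norm2 (x - y).
Proof.
move=> L0 /(_ x y) h.
rewrite -(sqr_sqrtr (norm2_ge0 (F x - F y))) -(sqr_sqrtr (norm2_ge0 (x - y))) -exprMn.
by rewrite ler_pXn2r ?nnegrE ?mulr_ge0 ?sqrtr_ge0.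
Qed.

End EuclideanDot.

(** * Coordinatewise limits and completeness *)

Section Completeness.
Context {R : realType} {d : nat}.
Local Notation vec := 'rV[R]_d.
Local Open Scope classical_set_scope.

Definition coord_cvg (u : nat -> vec) (l : vec) :=
  forall i, (fun n => u n 0 i) @ \oo --> l 0 i.

Lemma cvg_norm2B (u : nat -> vec) (l w : vec) : coord_cvg u l ->
  (fun n => norm2 (u n - w)) @ \oo --> norm2 (l - w).
Proof.
move=> ul; have e (z : vec) : norm2 (z - w) = \sum_i (z 0 i - w 0 i) * (z 0 i - w 0 i).
  by rewrite /norm2 dotvE; apply: eq_bigr => i _; rewrite !mxE.
rewrite e; under eq_fun do rewrite e.
apply: cvg_big => [|i _]; first exact: add_continuous.
by apply: cvgM; apply: cvgB => //; exact: cvg_cst.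
Qed.

Lemma coord_cauchy_cvg (u : nat -> vec) (b : nat -> R) : b @ \oo --> (0 : R) ->
  (forall n m, (n <= m)%N -> norm2 (u m - u n) <= b n) -> exists l, coord_cvg u l.
Proof.
move=> b0 ub.
suff c i : cvg ((fun n => u n 0 i) @ \oo).
  by exists (\row_i lim ((fun n => u n 0 i) @ \oo)) => i; rewrite mxE.
apply/cauchy_cvgP/cauchy_exP => e e0.
have [N _ bN] := cvgr0_norm_lt _ b0 (e ^+ 2) (exprn_gt0 2 e0).
exists (u N 0 i); exists N => // n /= Nn.
have he : 0 <= e by exact: ltW.
rewrite /ball /= distrC -(@ltr_pXn2r _ 2) ?nnegrE//.
rewrite real_normK ?num_real//.
have -> : u n 0 i - u N 0 i = (u n - u N) 0 i by rewrite !mxE.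
apply: le_lt_trans (norm2_coord _ _) _; apply: le_lt_trans (ub _ _ Nn) _.
by apply: le_lt_trans (ler_norm _) _; apply: bN => /=.
Qed.

End Completeness.

(** * Minty's theorem by minimization over a convex hull *)

Section Minty.
Context {R : realType} {d : nat}.
Local Notation vec := 'rV[R]_d.
Local Open Scope classical_set_scope.

(** The convex hull of the triples [(x, u, dotv x u)] over the graph, generated by binary
    combinations. The infimum of the third component above [(x, u)] is the convex envelope of the
    pairing restricted to the graph. *)
Inductive graph_hull (A : vec -> set vec) : vec -> vec -> R -> Prop :=
| graph_hull_pt x u : A x u -> graph_hull A x u (dotv x u)
| graph_hull_conv (t : R) x u c y v e : 0 <= t <= 1 ->
    graph_hull A x u c -> graph_hull A y v e ->
    graph_hull A ((1 - t) *: x + t *: y) ((1 - t) *: u + t *: v) ((1 - t) * c + t * e).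

(* The left-hand side is affine in each of the two hull points, so it is enough
   to check it on the graph, where it is the monotonicity inequality. *)
Lemma graph_hull_monotone {A : vec -> set vec} x u c y v e : monotone_op A ->
  graph_hull A x u c -> graph_hull A y v e ->
  0 <= c + e - dotv x v - dotv y u.
Proof.
move=> mA hx hy; elim: hx => {x u c} [x u Axu|t x u c x' u' c' t01 _ IH1 _ IH2].
  elim: hy => {y v e} [y v Ayv|t y v e y' v' e' t01 _ IH1 _ IH2].
    by have := mA _ _ _ _ Axu Ayv; rewrite !dotv_lin (dotvC u x) (dotvC v y)
      (dotvC u y) (dotvC v x); lra.
  rewrite !dotv_lin; nra.
rewrite !dotv_lin; nra.
Qed.

Lemma graph_hull_ge {A : vec -> set vec} x u c : monotone_op A ->
  graph_hull A x u c -> dotv x u <= c.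
Proof. by move=> mA h; have := graph_hull_monotone _ _ _ _ _ _ mA h h; lra. Qed.

(** At a graph point [(y, v)], completing the square in [z] turns [dotv (v - (w - z)) (y - z)] into
    [hull_gap] minus [norm2 (z - hull_center)]. The center is thus the best [z] for that single
    point, and the gap is the value reached there. *)
Definition hull_center (w x u : vec) : vec := 2^-1 *: (x - u + w).

Definition hull_gap (w x u : vec) (c : R) : R :=
  c - dotv w x + norm2 (hull_center w x u).

(** In this form both parts are visibly nonnegative on the hull, by [graph_hull_ge]. *)
Lemma hull_gapE w x u c :
  hull_gap w x u c = c - dotv x u + norm2 (2^-1 *: (x + u - w)).
Proof.
rewrite /hull_gap /hull_center /norm2 !dotv_lin (dotvC u x) (dotvC w x) (dotvC w u); lra.
Qed.

(** The center is affine in [(x, u)] and the rest of the gap is affine in [(x, u, c)], so the only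
    defect comes from the squared norm. *)
Lemma hull_gap_conv w (t : R) x u c y v e :
  hull_gap w ((1 - t) *: x + t *: y) ((1 - t) *: u + t *: v) ((1 - t) * c + t * e) =
  (1 - t) * hull_gap w x u c + t * hull_gap w y v e
  - t * (1 - t) * norm2 (hull_center w x u - hull_center w y v).
Proof.
have -> : hull_center w x u - hull_center w y v = 2^-1 *: ((x - u) - (y - v)).
  by rewrite -scalerBr; congr (_ *: _); apply/rowP => i; rewrite !mxE; ring.
rewrite /hull_gap /hull_center.
have -> : (1 - t) *: x + t *: y - ((1 - t) *: u + t *: v) + w =
   (1 - t) *: (x - u + w) + t *: (y - v + w).
  by apply/rowP => i; rewrite !mxE; ring.
have -> : (x - u) - (y - v) = (x - u + w) - (y - v + w).
  by apply/rowP => i; rewrite !mxE; ring.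
move: (x - u + w) (y - v + w) => a b.
rewrite !norm2Z !norm2D !norm2N !norm2Z !dotv_lin; ring.
Qed.

(* [hull_gap] is nonnegative and strongly convex along the hull, so the centers
   of a minimizing sequence converge; the limit is monotonically related to
   the whole graph. *)
Lemma monotone_extension_point {A : vec -> set vec} (w : vec) :
  monotone_op A -> (exists x u, A x u) ->
  exists z, forall y v, A y v -> 0 <= dotv (v - (w - z)) (y - z).
Proof.
move=> mA [x1 [u1 Axu1]].
pose E := [set r | exists x u c, graph_hull A x u c /\ r = hull_gap w x u c].
have gap0 x u c : graph_hull A x u c -> 0 <= hull_gap w x u c.
  move=> h; rewrite hull_gapE; have := graph_hull_ge _ _ _ mA h.
  have := norm2_ge0 (2^-1 *: (x + u - w)); lra.
have E0 : E !=set0.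
  by exists (hull_gap w x1 u1 (dotv x1 u1)), x1, u1, (dotv x1 u1); split => //; left.
have Elb : lbound E 0 by move=> r [x [u [c [h ->]]]]; exact: gap0.
have hE : has_inf E by split => //; exists 0.
set I := inf E.
have I0 : 0 <= I by exact: lb_le_inf.
have Ile x u c : graph_hull A x u c -> I <= hull_gap w x u c.
  by move=> h; apply: ge_inf; [exists 0 | exists x, u, c].
have /choice [p hp] : forall n : nat, exists p : vec * vec * R,
    graph_hull A p.1.1 p.1.2 p.2 /\ hull_gap w p.1.1 p.1.2 p.2 < I + n.+1%:R^-1.
  move=> n; have n0 : 0 < n.+1%:R^-1 :> R by rewrite invr_gt0 ltr0n.
  have [r [x [u [c [h ->]]]] lt] := inf_adherent n0 hE.
  by exists (x, u, c).
pose z n := hull_center w (p n).1.1 (p n).1.2.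
(* [I] is compared with the gap at fraction [t] of the way from the near-minimizer [p n] to the
   given hull point; division by [t] produces the factor [t^-1 - 1]. *)
have key n (t : R) x u c : 0 < t <= 1 -> graph_hull A x u c ->
    (1 - t) * norm2 (z n - hull_center w x u) <=
    hull_gap w x u c - I + (t^-1 - 1) * n.+1%:R^-1.
  move=> /andP[t0 t1] h; have [hn ltn] := hp n.
  have := Ile _ _ _ (graph_hull_conv A t _ _ _ _ _ _ ltac:(by rewrite ltW) hn h).
  rewrite hull_gap_conv -/(z n); move: ltn.
  move: (hull_gap w _ _ (p n).2) (hull_gap w x u c) => g g' ltn hI.
  move: (n.+1%:R^-1) ltn => ep ltn; rewrite -(ler_pM2l t0).
  have -> : t * (g' - I + (t^-1 - 1) * ep) = t * (g' - I) + (1 - t) * ep by field; lra.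
  have : 0 <= (1 - t) * (I + ep - g) by apply: mulr_ge0; lra.
  lra.
(* At [t = 1/2], half the squared distance is at most [1/(m+1) + 1/(n+1)], hence the constant 4. *)
have cau n m : (n <= m)%N -> norm2 (z m - z n) <= 4 * n.+1%:R^-1.
  move=> nm; have [hm ltm] := hp m.
  have := key n 2^-1 _ _ _ ltac:(lra) hm; rewrite -/(z m) => k.
  have : m.+1%:R^-1 <= n.+1%:R^-1 :> R by rewrite lef_pV2 ?posrE ?ltr0n// ler_nat ltnS.
  rewrite -norm2N opprB; move: k ltm; rewrite invrK.
  move: (m.+1%:R^-1) (n.+1%:R^-1) => em en; lra.
have [l zl] : exists l, coord_cvg z l.
  apply: (coord_cauchy_cvg _ (fun n => 4 * n.+1%:R^-1)) cau.
  by rewrite -(mulr0 4); apply: cvgMl_tmp; exact: cvg_harmonic.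
have lim x u c : graph_hull A x u c -> norm2 (l - hull_center w x u) <= hull_gap w x u c.
  move=> h.
  have H (t : R) : 0 < t <= 1 -> (1 - t) * norm2 (l - hull_center w x u) <= hull_gap w x u c.
    move=> t01.
    suff : (1 - t) * norm2 (l - hull_center w x u) <=
        hull_gap w x u c - I + (t^-1 - 1) * 0 by lra.
    apply: (@ler_cvg_to nat \oo _ R
      (fun n => (1 - t) * norm2 (z n - hull_center w x u))
      (fun n => hull_gap w x u c - I + (t^-1 - 1) * n.+1%:R^-1)).
    - by apply: cvgMl_tmp; exact: cvg_norm2B.
    - by apply: cvgD; [exact: cvg_cst | apply: cvgMl_tmp; exact: cvg_harmonic].
    - by apply: nearW => n; exact: key.
  apply/ler_addgt0Pr => e e0.
  set N := norm2 _ in H *; have N0 : 0 <= N by exact: norm2_ge0.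
  have D0 : 0 < 1 + N + e by lra.
  (* This is the limit [t -> 0] made explicit: this [t] lies in [(0, 1]] and satisfies
     [t * N <= e]. *)
  have := H (e / (1 + N + e)) ltac:(by rewrite divr_gt0//= ler_pdivrMr//; lra).
  have : e / (1 + N + e) * N <= e.
    by rewrite mulrAC ler_pdivrMr// ler_pM2l//; lra.
  lra.
exists l => y v Ayv; have := lim _ _ _ (graph_hull_pt _ _ _ Ayv).
rewrite /hull_gap norm2D norm2N dotvNr /hull_center dotvZr /norm2.
rewrite !dotv_lin (dotvC v y) (dotvC l w) (dotvC l y) (dotvC l v); lra.
Qed.

Lemma maximally_monotone_scale (c : R) (A : vec -> set vec) : 0 < c ->
  maximally_monotone A -> maximally_monotone (scale_op c A).
Proof.
move=> c0 [mA maxA]; split.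
  move=> x _ y _ [u Au <-] [v Av <-]; rewrite -scalerBr dotvZl.
  by rewrite mulr_ge0 ?(ltW c0)//; exact: mA.
move=> B mB AB x u Bxu; exists (c^-1 *: u); last by rewrite scalerA divff ?scale1r ?gt_eqF.
apply: (maxA (fun y v => B y (c *: v))).
- move=> y v y' v' h h'; have := mB _ _ _ _ h h'.
  by rewrite -scalerBr dotvZl pmulr_rge0.
- by move=> y v h; apply: AB; exists v.
- by rewrite scalerA divff ?scale1r ?gt_eqF.
Qed.

(** Adjoining the pair [(z, w - z)] found above keeps the graph monotone, so maximality puts the
    pair in [A]. *)
Theorem minty {A : vec -> set vec} : maximally_monotone A -> (exists x u, A x u) ->
  forall w, exists y, resolvent_rel A w y.
Proof.
move=> [mA maxA] Ane w; have [z hz] := monotone_extension_point w mA Ane.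
exists z; apply: (maxA (fun x u => A x u \/ x = z /\ u = w - z)); [|by left|by right].
move=> x u y v [Axu|[-> ->]] [Ayv|[-> ->]]; [exact: mA|exact: hz| |].
  by have := hz _ _ Ayv; rewrite -(opprB v) -(opprB y) dotvNl dotvNr opprK.
by rewrite subrr (_ : 0 = 0 *: (0 : vec)) ?dotvZl ?mul0r ?scaler0.
Qed.

End Minty.

(** * Existence and uniqueness of the resolvent of the sum *)

Section Resolvents.
Context {R : realType} {d : nat}.
Local Notation vec := 'rV[R]_d.
Local Open Scope classical_set_scope.

Lemma norm2_contraction_fixpoint (T : vec -> vec) (q : R) : 0 <= q < 1 ->
  (forall x y, norm2 (T x - T y) <= q * norm2 (x - y)) -> exists x, T x = x.
Proof.
move=> /andP[q0 q1] hT.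
pose r x := norm2 (x - T x); pose C := 4 * (3 - q) / (1 - q) ^+ 2.
(* Two points with small residuals are close to each other, so geometric decay of the residuals
   alone makes the iterates Cauchy, without summing increments. The Young weight [s = (1 - q) / 2]
   satisfies [(1 + s) * q + s <= 1], and [C] is [2 * s^-1 * (1 + s^-1)]. *)
have dist x y : norm2 (x - y) <= C * (r x + r y).
  have s0 : 0 < (1 - q) / 2 by lra.
  have e : x - y = (T x - T y) + ((x - T x) - (y - T y)).
    by apply/rowP => i; rewrite !mxE; ring.
  have := norm2D_young (T x - T y) ((x - T x) - (y - T y)) _ s0; rewrite -e.
  have := norm2D_le2 (x - T x) (- (y - T y)); rewrite norm2N -/(r x) -/(r y).
  have := hT x y; have := norm2_ge0 (x - y).
  move: (norm2 (x - T x - _)) (norm2 (T x - T y)) (norm2 (x - y)) (r x) (r y).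
  move=> P M N a b N0 MN Pab h.
  have -> : C * (a + b) = ((1 - q) / 2)^-1 * ((1 + ((1 - q) / 2)^-1) * (2 * (a + b))).
    by rewrite /C; field; lra.
  rewrite mulrC ler_pdivlMr//.
  set s := (1 - q) / 2 in s0 h *.
  have si : 0 < s^-1 by rewrite invr_gt0.
  have : (1 + s) * M <= (1 + s) * (q * N) by rewrite ler_pM2l; lra.
  have : (1 + s^-1) * P <= (1 + s^-1) * (2 * (a + b)) by rewrite ler_pM2l; lra.
  have : (1 + s) * q + s <= 1 by rewrite /s; nra.
  move=> hs; have : ((1 + s) * q + s) * N <= 1 * N by exact: ler_wpM2r.
  move: (_ * P) (_ * (2 * _)) h => X Y h; lra.
pose u n := iter n T 0.
have ru n : r (u n) <= q ^+ n * r 0.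
  elim: n => [|n IH]; first by rewrite expr0 mul1r.
  rewrite /r /u iterS -/(u n) exprS -mulrA.
  by apply: le_trans (hT _ _) _; exact: ler_wpM2l.
have C0 : 0 <= C by rewrite /C divr_ge0 ?exprn_ge0//; lra.
have r0 x : 0 <= r x by exact: norm2_ge0.
have cau n m : (n <= m)%N -> norm2 (u m - u n) <= (C * (2 * r 0)) * q ^+ n.
  move=> nm; apply: le_trans (dist _ _) _; rewrite -mulrA; apply: ler_wpM2l => //.
  have : q ^+ m * r 0 <= q ^+ n * r 0.
    by rewrite ler_wpM2r// ler_wiXn2l// ltW.
  have := ru n; have := ru m; move: (r 0) (q ^+ n) (q ^+ m) => r0' qn qm; lra.
have qn0 : (fun n => q ^+ n) @ \oo --> (0 : R).
  by apply: cvg_expr; rewrite ger0_norm.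
have [l ul] : exists l, coord_cvg u l.
  apply: (coord_cauchy_cvg _ (fun n => (C * (2 * r 0)) * q ^+ n)) cau.
  by rewrite -(mulr0 (C * (2 * r 0))); apply: cvgMl_tmp.
exists l; apply/eqP; rewrite -subr_eq0 -opprB oppr_eq0; apply/eqP/norm2_le0.
have -> : 0 = q * norm2 (l - l) :> R by rewrite subrr norm2_0 mulr0.
apply: (@ler_cvg_to nat \oo _ R (fun n => norm2 (u n.+1 - T l))
  (fun n => q * norm2 (u n - l))).
- have /= := @cvg_shiftS R (fun n => norm2 (u n - T l)) => ->.
  exact: cvg_norm2B.
- by apply: cvgMl_tmp; exact: cvg_norm2B.
- by apply: nearW => n; exact: hT.
Qed.

Lemma resolvent_nonexpansive (A : vec -> set vec) x y x' y' : monotone_op A ->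
  resolvent_rel A x y -> resolvent_rel A x' y' -> norm2 (y - y') <= norm2 (x - x').
Proof.
move=> mA h h'; have := mA _ _ _ _ h h'.
have -> : x - y - (x' - y') = (x - x') - (y - y') by apply/rowP => i; rewrite !mxE; ring.
rewrite dotvDl dotvNl -/(norm2 _); have := dotv_young (x - x') (y - y') 1 ltr01.
rewrite invr1; lra.
Qed.

(** The right-hand side says that [y] is the resolvent of [eta G] at [x - eta *: F y]: a fixed-point
    equation, and also the inclusion solved by FBF. *)
Lemma resolvent_sumP (F : vec -> vec) (G : vec -> set vec) (eta : R) x y :
  resolvent_rel (scale_op eta (sum_op F G)) x y <->
  scale_op eta G y (x - eta *: F y - y).
Proof.
split=> [[_ [g Gg <-] e]|[g Gg e]].
  by exists g => //; rewrite addrAC -e scalerDr addrC addKr.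
exists (F y + g); first by exists g.
by rewrite scalerDr e addrC addrAC subrK.
Qed.

Lemma resolvent_sum_exists (F : vec -> vec) (G : vec -> set vec) (L eta : R) x :
  0 <= L -> lipschitz_op F L -> maximally_monotone G -> (exists y v, G y v) ->
  0 < eta -> eta * L < 1 -> exists y, resolvent_rel (scale_op eta (sum_op F G)) x y.
Proof.
move=> L0 lF mG [y0 [v0 Gyv]] eta0 etaL.
have mA := maximally_monotone_scale eta G eta0 mG.
have Ane : exists y v, scale_op eta G y v by exists y0, (eta *: v0), v0.
have /choice [J hJ] := minty mA Ane.
have c0 : 0 <= eta * L by rewrite mulr_ge0// ltW.
have [|a b|y hy] := norm2_contraction_fixpoint (fun y => J (x - eta *: F y)) ((eta * L) ^+ 2).
- by rewrite sqr_ge0/= expr_lt1.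
- apply: le_trans (resolvent_nonexpansive _ _ _ _ _ mA.1 (hJ _) (hJ _)) _.
  have -> : x - eta *: F a - (x - eta *: F b) = - (eta *: (F a - F b)).
    by apply/rowP => i; rewrite !mxE; ring.
  rewrite norm2N norm2Z exprMn -[X in _ <= X]mulrA ler_pM2l ?exprn_gt0//.
  exact: lipschitz_op_norm2.
- by exists y; apply/resolvent_sumP; rewrite -{1 3}hy; exact: hJ.
Qed.

(** The identity contributes [norm2 (x - y)]; by Cauchy-Schwarz [eta F] removes at most [eta * L]
    times it. *)
Lemma id_plus_strongly_monotone (F : vec -> vec) (L eta : R) x y :
  0 <= L -> lipschitz_op F L -> 0 < eta ->
  (1 - eta * L) * norm2 (x - y) <= dotv (x + eta *: F x - (y + eta *: F y)) (x - y).
Proof.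
move=> L0 lF eta0.
have -> : x + eta *: F x - (y + eta *: F y) = eta *: (F x - F y) + (x - y).
  by apply/rowP => i; rewrite !mxE; ring.
rewrite dotvDl -/(norm2 _).
have c0 : 0 <= eta * L by rewrite mulr_ge0// ltW.
have := dotv_ge_of_norm2 (eta *: (F x - F y)) (x - y) _ c0.
rewrite norm2Z exprMn -[X in _ <= X]mulrA ler_pM2l ?exprn_gt0//.
move=> /(_ (lipschitz_op_norm2 _ _ _ _ L0 lF)).
lra.
Qed.

Lemma id_plus_lipschitz (F : vec -> vec) (L eta : R) x y :
  0 <= L -> lipschitz_op F L -> 0 < eta ->
  norm2 (x + eta *: F x - (y + eta *: F y)) <= (1 + eta * L) ^+ 2 * norm2 (x - y).
Proof.
move=> L0 lF eta0.
have -> : x + eta *: F x - (y + eta *: F y) = - (- (eta *: (F x - F y)) - (x - y)).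
  by apply/rowP => i; rewrite !mxE; ring.
have c0 : 0 <= eta * L by rewrite mulr_ge0// ltW.
have hF : norm2 (eta *: (F x - F y)) <= (eta * L) ^+ 2 * norm2 (x - y).
  rewrite norm2Z exprMn -[X in _ <= X]mulrA ler_pM2l ?exprn_gt0//; exact: lipschitz_op_norm2.
have := dotv_ge_of_norm2 (- (eta *: (F x - F y))) (x - y) _ c0.
rewrite norm2N => /(_ hF); rewrite norm2N.
move: (eta *: (F x - F y)) (x - y) hF => w v hF; rewrite norm2D !norm2N dotvNr; lra.
Qed.

(** Monotonicity of [G] makes the strongly monotone pairing of [Id + eta F] nonpositive at
    [y - y']. *)
Lemma resolvent_sum_unique (F : vec -> vec) (G : vec -> set vec) (L eta : R) x y y' :
  0 <= L -> lipschitz_op F L -> monotone_op G -> 0 < eta -> eta * L < 1 ->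
  resolvent_rel (scale_op eta (sum_op F G)) x y ->
  resolvent_rel (scale_op eta (sum_op F G)) x y' -> y = y'.
Proof.
move=> L0 lF mG eta0 etaL /resolvent_sumP[g Gg e] /resolvent_sumP[g' Gg' e'].
have := mG _ _ _ _ Gg Gg'; rewrite -(pmulr_rge0 _ eta0) -dotvZl scalerBr e e'.
have -> : x - eta *: F y - y - (x - eta *: F y' - y') =
  - (y + eta *: F y - (y' + eta *: F y')) by apply/rowP => i; rewrite !mxE; ring.
rewrite dotvNl; have := id_plus_strongly_monotone _ _ _ y y' L0 lF eta0.
move=> h1 h2; apply/eqP; rewrite -subr_eq0; apply/eqP/norm2_le0.
rewrite -(pmulr_rle0 _ (_ : 0 < 1 - eta * L)); lra.
Qed.

End Resolvents.

(** * Contraction of one FBF step *)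

Section ForwardBackwardForward.
Context {R : realType} {d : nat}.
Local Notation vec := 'rV[R]_d.

Lemma fbf_step_contraction (A : vec -> set vec) (B : vec -> vec) (mu LB : R)
    (z zh zs : vec) : monotone_op A -> 0 < mu -> 0 < LB ->
  (forall x y, mu * norm2 (x - y) <= dotv (B x - B y) (x - y)) ->
  (forall x y, norm2 (B x - B y) <= LB ^+ 2 * norm2 (x - y)) ->
  A zs (- B zs) ->
  let tau := (2 * LB)^-1 in let q := mu / LB in
  resolvent_rel (scale_op tau A) (z - tau *: B z) zh ->
  (3 + 4 * q) * norm2 (zh + tau *: B z - tau *: B zh - zs) <= (3 + q) * norm2 (z - zs).
Proof.
move=> mA mu0 LB0 strong lip hs tau q [a Aa ea].
have tau0 : 0 < tau by rewrite invr_gt0; lra.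
have q0 : 0 < q by rewrite divr_gt0.
have mon : 0 <= dotv (z - tau *: B z - zh + tau *: B zs) (zh - zs).
  have := mA _ _ _ _ Aa hs; rewrite -(pmulr_rge0 _ tau0) -dotvZl.
  by rewrite opprK scalerDr ea.
have str : q / 2 * norm2 (zh - zs) <= tau * dotv (B zh - B zs) (zh - zs).
  have -> : q / 2 * norm2 (zh - zs) = tau * (mu * norm2 (zh - zs)).
    by rewrite /q /tau; field; lra.
  by rewrite ler_pM2l.
have lp : norm2 (tau *: (B z - B zh)) <= 4^-1 * norm2 (z - zh).
  rewrite norm2Z; have -> : 4^-1 * norm2 (z - zh) = tau ^+ 2 * (LB ^+ 2 * norm2 (z - zh)).
    by rewrite /tau; field; lra.
  by rewrite ler_pM2l ?exprn_gt0.
(* This weight makes the two Young coefficients proportional to [3/4] and [q], the coefficients of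
   the decrease in [dec]. The decrease is then at least [3q / (3 + 4q)] of [norm2 (z - zs)]. *)
have s0 : 0 < 3 / (4 * q) by rewrite divr_gt0//; lra.
have := norm2D_young (z - zh) (zh - zs) _ s0; rewrite subrKA => yg.
have {}yg : 3 * q * norm2 (z - zs) <=
    (3 + 4 * q) * (3 / 4 * norm2 (z - zh) + q * norm2 (zh - zs)).
  have -> : (3 + 4 * q) * (3 / 4 * norm2 (z - zh) + q * norm2 (zh - zs)) =
    3 * q * ((1 + 3 / (4 * q)) * norm2 (z - zh) + (1 + (3 / (4 * q))^-1) * norm2 (zh - zs)).
    by field; lra.
  by rewrite ler_pM2l; lra.
(* The coefficient [3/4] is [1 - (tau * LB)^2], and [q] is [2 * tau * mu]. *)
have dec : norm2 (zh + tau *: B z - tau *: B zh - zs) <=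
    norm2 (z - zs) - (3 / 4 * norm2 (z - zh) + q * norm2 (zh - zs)).
  have -> : zh + tau *: B z - tau *: B zh - zs = (zh - zs) + tau *: (B z - B zh).
    by apply/rowP => i; rewrite !mxE; ring.
  have -> : norm2 (z - zs) = norm2 ((z - zh) + (zh - zs)) by rewrite subrKA.
  move: mon str; rewrite -(dotvZl tau).
  have -> : z - tau *: B z - zh + tau *: B zs =
    (z - zh) - tau *: (B z - B zh) - tau *: (B zh - B zs).
    by apply/rowP => i; rewrite !mxE; ring.
  move: (z - zh) (zh - zs) (tau *: (B z - B zh)) (tau *: (B zh - B zs)) lp => p r e f.
  rewrite !norm2D !dotvDl !dotvNl (dotvC r e); lra.
have : (3 + 4 * q) * norm2 (zh + tau *: B z - tau *: B zh - zs) <=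
  (3 + 4 * q) * (norm2 (z - zs) - (3 / 4 * norm2 (z - zh) + q * norm2 (zh - zs))).
  by rewrite ler_pM2l; lra.
lra.
Qed.

End ForwardBackwardForward.

(** * Linear rate of FBF and the inner iteration count *)

Section FbfComplexity.
Context {R : realType} {d : nat}.
Local Notation vec := 'rV[R]_d.

Lemma fbf_run_counts (A : vec -> set vec) (Bin : vec -> vec) (LB : R) z0 N :
  (fbf_run A Bin LB z0 N).1.2 = (2 * N)%N /\ (fbf_run A Bin LB z0 N).2 = N.
Proof.
elim: N => [//|N]; rewrite /fbf_run iterS -/(fbf_run A Bin LB z0 N).
by case: (fbf_run _ _ _ _ _) => [[z nB] nJ] /= [-> ->]; rewrite mulnS addnC.
Qed.

Lemma fbf_linear_rate (A : vec -> set vec) (Bin : vec -> vec) (mu LB : R) z0 zs N :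
  maximally_monotone A -> 0 < mu -> 0 < LB ->
  (forall x y, mu * norm2 (x - y) <= dotv (Bin x - Bin y) (x - y)) ->
  (forall x y, norm2 (Bin x - Bin y) <= LB ^+ 2 * norm2 (x - y)) ->
  A zs (z0 - Bin zs) ->
  norm2 (fbf A Bin LB z0 N - zs) <=
  ((3 + mu / LB) / (3 + 4 * (mu / LB))) ^+ N * norm2 (z0 - zs).
Proof.
move=> mA mu0 LB0 strong lip hs.
have q0 : 0 < mu / LB by rewrite divr_gt0.
have tau0 : 0 < (2 * LB)^-1 by rewrite invr_gt0; lra.
have mtA := maximally_monotone_scale _ _ tau0 mA.
have ne : exists y v, scale_op (2 * LB)^-1 A y v.
  by exists zs, ((2 * LB)^-1 *: (z0 - Bin zs)), (z0 - Bin zs).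
have e x y : Bin x - z0 - (Bin y - z0) = Bin x - Bin y.
  by apply/rowP => i; rewrite !mxE; ring.
elim: N => [|N IH]; first by rewrite expr0 mul1r.
rewrite exprS -mulrA; apply: le_trans (ler_wpM2l _ IH); last by rewrite divr_ge0; lra.
rewrite /fbf /fbf_run iterS -/(fbf_run A Bin LB z0 N).
case: (fbf_run _ _ _ _ _) => [[z nB] nJ] /=.
rewrite mulrAC ler_pdivlMr; last by lra.
rewrite mulrC; apply: (fbf_step_contraction A (fun z => Bin z - z0)) => //.
- exact: mA.1.
- by move=> x y; rewrite e.
- by move=> x y; rewrite e.
- by rewrite opprB.
(* [resolvent_pt] returns its argument when the resolvent set is empty; Minty's theorem rules this
   default out. *)
- by apply: xgetPex; exact: minty.
Qed.

Lemma fbf_factor_le_expR (q : R) : 0 <= q <= 1 ->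
  (3 + q) / (3 + 4 * q) <= expR (- (q / 2)).
Proof.
(* The tangent bound [1 - q/2] is too weak: at [q = 1] it gives [1/2 < 4/7]. The cube of the tangent
   bound at [q/6] gives [125/216 > 4/7]. *)
move=> q01; apply: (@le_trans _ _ ((1 - q / 6) ^+ 3)).
  rewrite ler_pdivrMr; last by lra.
  rewrite !exprS expr0; nra.
have -> : - (q / 2) = 3%:R * (- (q / 6)) by lra.
rewrite expRM_natl ler_pXn2r ?nnegrE ?expR_ge0//; first exact: expR_ge1Dx.
lra.
Qed.

(** From [ln (n^-1) <= n^-1 - 1] one gets [ln n >= 1 - 1/n]. *)
Lemma ln_ge_half (n : nat) : (2 <= n)%N -> 2^-1 <= ln (n%:R : R).
Proof.
move=> n2; have n0 : 0 < n%:R :> R by rewrite ltr0n (leq_trans _ n2).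
have h : 2 <= n%:R :> R by rewrite ler_nat.
have := @le_ln1Dx R (n%:R^-1 - 1).
rewrite [1 + _]addrC subrK lnV ?posrE//.
have : n%:R^-1 <= 2^-1 :> R by rewrite lef_pV2 ?posrE.
have : 0 < n%:R^-1 :> R by rewrite invr_gt0.
move: (n%:R^-1) (ln _) => a b a0 a2 hh.
have := hh ltac:(lra). lra.
Qed.

Lemma Nk_ge (eta L : R) (k : nat) :
  4 * (1 + eta * L) / (1 - eta * L) * ln (98 * Num.sqrt (k.+2%:R) * ln (k.+2%:R))
  <= (Nk eta L k)%:R.
Proof.
rewrite /Nk natr_absz; apply: le_trans (ceil_ge _) _.
by rewrite ler_int ler_norm.
Qed.

(** The inverse square of the argument of the logarithm in [Nk]; [9604] is [98^2]. *)
Definition fbf_err (k : nat) : R := (9604 * (k.+2%:R * ln (k.+2%:R) ^+ 2))^-1.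

Lemma inexact_resolvent_err (F : vec -> vec) (G : vec -> set vec) (L eta : R) k x y :
  0 <= L -> lipschitz_op F L -> maximally_monotone G ->
  0 < eta -> eta * L < 1 ->
  resolvent_rel (scale_op eta (sum_op F G)) x y ->
  norm2 (inexact_resolvent F G eta L k x - y) <= fbf_err k * norm2 (x - y).
Proof.
move=> L0 lF mG eta0 etaL /resolvent_sumP hy.
have c0 : 0 <= eta * L by rewrite mulr_ge0// ltW.
have mA := maximally_monotone_scale eta G eta0 mG.
pose mu := 1 - eta * L; pose LB := 1 + eta * L; pose q := mu / LB.
have mu0 : 0 < mu by rewrite /mu; lra.
have LB0 : 0 < LB by rewrite /LB; lra.
have q0 : 0 < q by rewrite divr_gt0.
have q1 : q <= 1 by rewrite ler_pdivrMr// /mu /LB; lra.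
apply: le_trans (fbf_linear_rate _ _ mu _ _ y _ mA mu0 LB0 _ _ _) _.
- by move=> a b; exact: id_plus_strongly_monotone.
- by move=> a b; exact: id_plus_lipschitz.
- by rewrite opprD addrA addrAC.
apply: ler_wpM2r; first exact: norm2_ge0.
rewrite -/q; set N := Nk _ _ _; pose X : R := 98 * Num.sqrt k.+2%:R * ln k.+2%:R.
have k0 : 0 < k.+2%:R :> R by rewrite ltr0n.
have ln0 : 0 < ln k.+2%:R :> R by apply: lt_le_trans (ln_ge_half _ _) => //; lra.
have X0 : 0 < X by rewrite !mulr_gt0 ?sqrtr_gt0//.
have -> : fbf_err k = (X^-1) ^+ 2.
  by rewrite /fbf_err /X exprVn !exprMn sqr_sqrtr ?ltW// -natrX mulrA.
apply: (@le_trans _ _ (expR (- (q / 2)) ^+ N)).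
  rewrite lerXn2r ?nnegrE ?expR_ge0 ?divr_ge0 ?fbf_factor_le_expR//; lra.
rewrite -expRM_natl -[X^-1]lnK ?posrE ?invr_gt0// -expRM_natl ler_expR lnV ?posrE//.
have := Nk_ge eta L k; rewrite -/N -/X -/mu -/LB.
(* Since [LB / mu = 1/q], the choice of [N] says [N * (q/2) >= 2 * ln X], which yields the factor
   [X^-2] on squared distances. *)
have -> : 4 * LB / mu * ln X = (2 * ln X) / (q / 2) by rewrite /q; field; lra.
by rewrite ler_pdivrMr; lra.
Qed.

End FbfComplexity.

(** * Summability of the error weights *)

Section ErrorSums.
Context {R : realType}.

(** This is [ln (1 + t) <= t] at [t = - 1/(n+1)], where [1 + t = n/(n+1)]. *)
Lemma ln_step_ge (n : nat) : (1 <= n)%N ->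
  (n.+1%:R)^-1 <= ln (n.+1%:R) - ln (n%:R) :> R.
Proof.
move=> n1; have n0 : 0 < n%:R :> R by rewrite ltr0n.
have n0' : 0 < n.+1%:R :> R by rewrite ltr0n.
have i0 : 0 < n.+1%:R^-1 :> R by rewrite invr_gt0.
have e : 1 - n.+1%:R^-1 = n%:R / n.+1%:R :> R by rewrite -[n.+1]addn1 natrD; field; lra.
have := @le_ln1Dx R (- n.+1%:R^-1); rewrite e lnM ?posrE// lnV ?posrE//.
have : 0 < n%:R / n.+1%:R :> R by rewrite divr_gt0.
rewrite -e; move: (n.+1%:R^-1) (ln _) (ln _) => i a b i1 hi; have := hi ltac:(lra); lra.
Qed.

(* The terms telescope against [- 1 / ln n]. *)
Lemma sum_inv_xlnx2_le (k : nat) :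
  \sum_(i < k.+1) (i.+2%:R * ln (i.+2%:R) ^+ 2)^-1 <= 4 - (ln k.+2%:R)^-1 :> R.
Proof.
have inv n : (2 <= n)%N -> 0 < (ln (n%:R : R))^-1 <= 2.
  move=> n2; have h := @ln_ge_half R n n2; have h0 : 0 < ln (n%:R : R) by lra.
  by rewrite invr_gt0 h0 /= -[leRHS]invrK lef_pV2 ?posrE// invr_gt0.
elim: k => [|k IH].
  (* The constant 4 is fixed here: [a = 1 / ln 2 <= 2] gives [a^2 / 2 + a <= 4]. *)
  rewrite big_ord_recl big_ord0 addr0 /= invfM -exprVn.
  have := inv 2%N erefl; move: (_^-1) => a. nra.
rewrite big_ord_recr /=.
have := ln_step_ge k.+2 erefl; have := inv k.+2 erefl; have := inv k.+3 erefl.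
move: IH; rewrite invfM -exprVn.
set a := ln k.+3%:R; set b := ln k.+2%:R; set m := k.+3%:R^-1.
move=> IH /andP[a0 _] /andP[b0 _] hm.
have {}a0 : 0 < a by rewrite -invr_gt0.
have {}b0 : 0 < b by rewrite -invr_gt0.
have m0 : 0 < m by rewrite invr_gt0 ltr0n.
suff : m * a^-1 ^+ 2 <= b^-1 - a^-1 by move: (b^-1) (a^-1) IH => ? ?; lra.
have -> : b^-1 - a^-1 = (a - b) * (a^-1 * b^-1) by field; lra.
apply: ler_pM; [exact: ltW|by rewrite exprn_ge0// invr_ge0 ltW|by []|].
by rewrite expr2 ler_pM2l ?invr_gt0// lef_pV2 ?posrE//; lra.
Qed.

(** The terms telescope through [1/(n+1)^2 <= 1/n - 1/(n+1)]. *)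
Lemma sum_inv_sqr_le (k : nat) :
  \sum_(i < k.+1) (i.+1%:R ^+ 2)^-1 <= 2 - (k.+1%:R)^-1 :> R.
Proof.
elim: k => [|k IH]; first by rewrite big_ord_recl big_ord0 addr0 /= expr1n invr1; lra.
rewrite big_ord_recr /= -[k.+2]addn1 natrD; move: IH; set n := k.+1%:R => IH.
have n0 : 0 < n by rewrite ltr0n.
suff : ((n + 1) ^+ 2)^-1 <= n^-1 - (n + 1)^-1.
  by move: (n^-1) ((n+1)^-1) (_^-1) IH => ? ? ?; lra.
have -> : n^-1 - (n + 1)^-1 = (n * (n + 1))^-1 by field; lra.
by rewrite lef_pV2 ?posrE ?mulr_gt0//; nra.
Qed.

Lemma sum_err_le (k : nat) :
  \sum_(i < k) ((i.+2%:R * ln (i.+2%:R) ^+ 2)^-1 + (i.+1%:R ^+ 2)^-1) <= 6 :> R.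
Proof.
case: k => [|k]; first by rewrite big_ord0.
rewrite big_split /=; have := sum_inv_xlnx2_le k; have := sum_inv_sqr_le k.
have : 0 <= (ln k.+2%:R)^-1 :> R by rewrite invr_ge0 ln_ge0// ler1n.
have : 0 <= k.+1%:R^-1 :> R by rewrite invr_ge0.
move: (_^-1) (_^-1) => ? ?; lra.
Qed.

End ErrorSums.

(** * Potential argument for Halpern iteration with errors *)

Section InexactHalpern.
Context {R : realType} {d : nat}.
Local Notation vec := 'rV[R]_d.

(** Here [n] stands for [k + 1], [g] for [S x_k] and [p] for [x_k - x_0]. *)
Definition halpern_potential (n : R) (g p : vec) : R :=
  (n - 1) * n / 2 * norm2 g + n * dotv g p.

(* The slack [n (n + 1) / 2 |g' - g|^2] of the exact argument absorbs
   [n (n + 1) <g' - g, e>]; this is why only [|e|^2], not [|e|], has to be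
   summable against the weights. *)
Lemma halpern_potential_step (n : R) (g g' p p' e : vec) : 0 < n ->
  p' = (n / (n + 1)) *: (p - g + e) ->
  norm2 (g' - g) <= dotv (g' - g) (p' - p) ->
  halpern_potential (n + 1) g' p' <=
  halpern_potential n g p + (n * (n + 1) / 2) * norm2 e + n * dotv g e.
Proof.
move=> n0 hp coco.
have eq (h : vec) : (n + 1) * dotv h p' = n * (dotv h p - dotv h g + dotv h e).
  by rewrite hp !dotv_lin; field; lra.
(* [h1] is weighted cocoercivity and [h2] the square that absorbs the error; [e1] and [e2] eliminate
   [p']. The claim is then a linear combination of these. *)
have h1 : 0 <= n * (n + 1) * (dotv (g' - g) (p' - p) - norm2 (g' - g)).
  by rewrite !mulr_ge0//; lra.
have h2 : 0 <= n * (n + 1) / 2 * norm2 (g' - g - e).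
  by rewrite mulr_ge0 ?norm2_ge0//; apply: divr_ge0 => //; apply: mulr_ge0; lra.
have e1 := congr1 (fun r => n * r) (eq g).
have e2 := congr1 (fun r => (n + 1) * r) (eq g').
move: h1 h2 e1 e2; rewrite /halpern_potential /norm2 /= !dotv_lin.
rewrite (dotvC g g') (dotvC e g) (dotvC e g').
move: (dotv g' p') (dotv g p') (dotv g' p) (dotv g p) (dotv g' g) (dotv g e) (dotv g' e).
move=> a1 a2 a3 a4 a5 a6 a7; lra.
Qed.

(** Strong induction on [k]: the rate at all [j < k] bounds the errors made so far, hence the
    potential at [k], and this gives the rate at [k]. *)
Lemma inexact_halpern_rate (S : vec -> vec) (x : nat -> vec) (err : nat -> vec) (xs : vec) :
  (forall a b, norm2 (S a - S b) <= dotv (S a - S b) (a - b)) ->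
  S xs = 0 ->
  (forall k, x k.+1 = k.+2%:R^-1 *: x 0%N
                      + (1 - k.+2%:R^-1) *: (x k - S (x k) + err k)) ->
  (forall k, norm2 (err k) <= fbf_err k * norm2 (S (x k))) ->
  forall k, k.+1%:R ^+ 2 * norm2 (S (x k)) <= 16 * norm2 (x 0%N - xs).
Proof.
move=> coco S0 hx herr; set D := norm2 (_ - xs).
have D0 : 0 <= D by exact: norm2_ge0.
pose w i : R := (i.+2%:R * ln (i.+2%:R) ^+ 2)^-1 + (i.+1%:R ^+ 2)^-1.
pose E k := halpern_potential k.+1%:R (S (x k)) (x k - x 0%N).
have bound k : E k <= 4 * D -> k.+1%:R ^+ 2 * norm2 (S (x k)) <= 16 * D.
  rewrite /E /halpern_potential; set n : R := k.+1%:R.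
  have n1 : 1 <= n by rewrite ler1n.
  have := coco (x k) xs; rewrite S0 subr0; set g := S (x k).
  have -> : x k - x 0%N = (x k - xs) - (x 0%N - xs) by apply/rowP => i; rewrite !mxE; ring.
  rewrite (dotvDr (x k - xs)) dotvNr.
  (* With cocoercivity at [xs], this weight leaves [(3/8) n^2 |g|^2 <= 6 D], hence the constant
     16. *)
  have s0 : 0 < 4^-1 :> R by lra.
  have := dotv_young (n *: g) (x 0%N - xs) _ s0; rewrite norm2Z dotvZl invrK -/D.
  have := norm2_ge0 g.
  move: (norm2 g) (dotv g (x k - xs)) (dotv g (x 0%N - xs)) => N a b N0 yg h1 h2.
  have h3 : n * N <= n * a by rewrite ler_pM2l; lra.
  have h4 : 0 <= n * N by rewrite mulr_ge0//; lra.
  lra.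
have step k : k.+1%:R ^+ 2 * norm2 (S (x k)) <= 16 * D ->
    E k.+1 <= E k + 16 * D * (w k / 100).
  move=> Hk.
  have k0 : 0 < k.+1%:R :> R by rewrite ltr0n.
  have k1 : 1 <= k.+1%:R :> R by rewrite ler1n.
  have e2 : k.+2%:R = k.+1%:R + 1 :> R by rewrite -[k.+2]addn1 natrD.
  have hp : x k.+1 - x 0%N =
      (k.+1%:R / (k.+1%:R + 1)) *: ((x k - x 0%N) - S (x k) + err k).
    have -> : k.+1%:R / (k.+1%:R + 1) = 1 - k.+2%:R^-1 :> R.
      by rewrite e2; move: (k.+1%:R : R) k0 => n n0; field; rewrite gt_eqF//; lra.
    by rewrite hx; apply/rowP => i; rewrite !mxE; ring.
  have hc : norm2 (S (x k.+1) - S (x k)) <=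
      dotv (S (x k.+1) - S (x k)) ((x k.+1 - x 0%N) - (x k - x 0%N)).
    have -> : (x k.+1 - x 0%N) - (x k - x 0%N) = x k.+1 - x k.
      by apply/rowP => i; rewrite !mxE; ring.
    exact: coco.
  have := halpern_potential_step _ _ _ _ _ _ k0 hp hc; rewrite -e2 -/(E k.+1) -/(E k).
  rewrite e2; move: Hk (herr k) => Hk hk; move/le_trans; apply.
  rewrite -addrA lerD2l.
  (* Young turns [n <g, e>] into [|g|^2 / 196] plus [49 n^2 |e|^2]. With the quadratic term this
     makes at most [50 n^2 |e|^2], and [50 / 98^2 <= 1/100]. *)
  have s0 : 0 < 98^-1 :> R by lra.
  have := dotv_young (S (x k)) (k.+1%:R *: err k) _ s0.
  rewrite norm2Z dotvZr invrK.
  have c0 : 0 <= 9604^-1 :> R by lra.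
  have c50 : 50 * 9604^-1 <= 100^-1 :> R by lra.
  rewrite /w mulrDl; move: hk; rewrite /fbf_err invfM.
  move: (9604^-1) c0 c50 => c c0 c50.
  set v := (_ * ln _ ^+ 2)^-1.
  have v0 : 0 <= v by rewrite invr_ge0 mulr_ge0// sqr_ge0.
  have gk : norm2 (S (x k)) <= 16 * D * (k.+1%:R ^+ 2)^-1.
    by rewrite ler_pdivlMr ?exprn_gt0// mulrC.
  move: gk; set i2 := (k.+1%:R ^+ 2)^-1 => gk.
  have i20 : 0 <= i2 by rewrite invr_ge0 sqr_ge0.
  move: (norm2_ge0 (S (x k))) (norm2_ge0 (err k)) Hk gk.
  move: (norm2 (S (x k))) (norm2 (err k)) (dotv (S (x k)) (err k)) => g e ge g0 e0 Hk gk hk yg.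
  set n : R := k.+1%:R in k0 k1 Hk yg *.
  have h1 : n ^+ 2 * e <= c * v * (16 * D).
    apply: (@le_trans _ _ (n ^+ 2 * (c * v * g))).
      by rewrite ler_pM2l ?exprn_gt0.
    by rewrite mulrCA ler_wpM2l// mulr_ge0.
  have h2 : n * (n + 1) / 2 * e <= n ^+ 2 * e by apply: ler_wpM2r => //; nra.
  have h3 : 0 <= v * D by rewrite mulr_ge0.
  have h4 : 0 <= D * i2 by rewrite mulr_ge0.
  have h5 : 50 * c * (v * D) <= 100^-1 * (v * D) by exact: ler_wpM2r.
  lra.
have sum k : (forall j, (j < k)%N -> j.+1%:R ^+ 2 * norm2 (S (x j)) <= 16 * D) ->
    E k <= 16 * D * ((\sum_(i < k) w i) / 100).
  elim: k => [_|k IH hj].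
    (* The potential starts at 0: both [n - 1] and [x 0 - x 0] vanish. *)
    rewrite big_ord0 mul0r mulr0 /E /halpern_potential !subrr.
    by rewrite -[X in dotv _ X](scale0r (0 : vec)) dotvZr !mul0r mulr0 addr0.
  apply: le_trans (step _ (hj _ (ltnSn k))) _.
  have {}IH := IH (fun j jk => hj _ (ltnW jk)).
  by rewrite big_ord_recr /=; move: (\sum_(i < k) w i) (w k) (E k) IH => W v e; lra.
move=> k; have [m] := ubnP k; elim: m k => [//|m IH] k km.
apply: bound; apply: le_trans (sum _ _) _ => [j jk|].
  by apply: IH; exact: leq_trans jk _.
(* The accumulated increase is at most [16 * 6 / 100] times [D], below the allowed [4 * D]. *)
have := @sum_err_le R k; rewrite -/w; set W := \sum_(i < k) _ => hW.
have : 16 * D * (W / 100) <= 16 * D * (6 / 100) by apply: ler_wpM2l; lra.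
lra.
Qed.

End InexactHalpern.

(** * Cocoercivity of the scaled residual and the final rate *)

(** Writing [x - a = eta *: u], the scaled residual is [(eta - rho) *: u]. Substituting
    [a = x - eta *: u] in cohypomonotonicity moves [eta |u - v|^2] across and leaves the modulus
    [eta - rho]. *)
Lemma cohypomonotone_resolvent_cocoercive {R : realType} {d : nat}
    (A : 'rV[R]_d -> set 'rV[R]_d)
    (rho eta : R) x y a b : 0 < eta -> rho < eta -> cohypomonotone rho A ->
  resolvent_rel (scale_op eta A) x a -> resolvent_rel (scale_op eta A) y b ->
  norm2 ((1 - rho / eta) *: (x - a) - (1 - rho / eta) *: (y - b)) <=
  dotv ((1 - rho / eta) *: (x - a) - (1 - rho / eta) *: (y - b)) (x - y).
Proof.
move=> eta0 rhoeta co [u Au eu] [v Av ev].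
have -> : (1 - rho / eta) *: (x - a) - (1 - rho / eta) *: (y - b) = (eta - rho) *: (u - v).
  rewrite -eu -ev -scalerBr -scalerBr scalerA; congr (_ *: _); field; lra.
have := co _ _ _ _ Au Av.
have -> : a - b = (x - y) - eta *: (u - v).
  by rewrite scalerBr eu ev; apply/rowP => i; rewrite !mxE; ring.
rewrite dotvDr dotvNr dotvZr norm2Z dotvZl -/(norm2 _) expr2 -mulrA => h.
by rewrite ler_pM2l; lra.
Qed.

Theorem theorem2p1 (R : realType) (d : nat)
  (F : 'rV[R]_d -> 'rV[R]_d) (G : 'rV[R]_d -> set 'rV[R]_d) (L rho eta : R)
  (x0 : 'rV[R]_d) (K : nat) :
  0 <= L -> lipschitz_op F L ->
  maximally_monotone G ->
  (exists xs, G xs (- F xs)) ->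
  0 < rho -> maximally_cohypomonotone rho (sum_op F G) ->
  0 < eta -> eta * L < 1 -> rho < eta ->
  (1 <= K)%N ->
  forall xstar, G xstar (- F xstar) ->
  (forall k : nat, (1 <= k <= K)%N ->
     (exists y, resolvent_rel (scale_op eta (sum_op F G)) (halpern F G eta L rho x0 k) y) /\
     (forall y, resolvent_rel (scale_op eta (sum_op F G)) (halpern F G eta L rho x0 k) y ->
        eta ^- 2 * norm2 (halpern F G eta L rho x0 k - y)
        <= 16 * norm2 (x0 - xstar) / ((eta - rho) ^+ 2 * (k.+1%:R) ^+ 2))) /\
  (forall k : nat, (k < K)%N ->
     (oracle_calls F G eta L k (halpern F G eta L rho x0 k) <= 2 * Nk eta L k)%N).
Proof.
move=> L0 lF mG _ rho0 [coh _] eta0 etaL rhoeta _ xstar hxs.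
split=> [|k _]; last first.
  (* Each FBF step makes two evaluations of [F] and one resolvent evaluation, so the larger count is
     [2 * Nk]. *)
  rewrite /oracle_calls; have [-> ->] := fbf_run_counts (scale_op eta G)
    (fun z => z + eta *: F z) (1 + eta * L) (halpern F G eta L rho x0 k) (Nk eta L k).
  by rewrite geq_max leqnn mul2n -addnn leq_addr.
have ex x : exists y, resolvent_rel (scale_op eta (sum_op F G)) x y.
  by apply: resolvent_sum_exists lF _ _ _ _ => //; exists xstar, (- F xstar).
have uniq x y y' := resolvent_sum_unique F G L eta x y y' L0 lF mG.1 eta0 etaL.
have /choice [J hJ] := ex.
(* Solutions are fixed points of [J], hence zeros of [S]; uniqueness makes this hold for the chosen
   [J]. *)
have Jxs : J xstar = xstar.
  apply: uniq (hJ _) _; apply/resolvent_sumP; exists (- F xstar) => //.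
  by rewrite scalerN addrAC subrr add0r.
pose al := 1 - rho / eta; pose S x := al *: (x - J x).
pose X := halpern F G eta L rho x0.
have rate := inexact_halpern_rate S X
  (fun k => al *: (inexact_resolvent F G eta L k (X k) - J (X k))) xstar.
move=> k _; split=> [|y hy]; first exact: ex.
rewrite (uniq _ _ _ hy (hJ _)) -/(X k).
(* The factor [(1 - rho / eta) / (eta - rho)] equals [1 / eta]. *)
have -> : eta ^- 2 * norm2 (X k - J (X k)) = norm2 (S (X k)) / (eta - rho) ^+ 2.
  by rewrite /S /al norm2Z; field; lra.
rewrite [X in _ <= _ * X]invfM [X in _ <= _ * X]mulrC [X in _ <= X]mulrA.
apply: ler_wpM2r; first by rewrite invr_ge0 sqr_ge0.
rewrite ler_pdivlMr ?exprn_gt0 ?ltr0n// mulrC.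
apply: rate => [a b||j|j].
- exact: cohypomonotone_resolvent_cocoercive coh (hJ a) (hJ b).
- by rewrite /S Jxs subrr scaler0.
- rewrite /X /= -/X; congr (_ + _ *: _).
  by rewrite /S -/al; apply/rowP => i; rewrite !mxE; ring.
- rewrite /S !norm2Z mulrCA ler_wpM2l ?sqr_ge0//.
  exact: inexact_resolvent_err.
Qed.
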